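(* Let $P$ be a full dimensional lattice polytope in $\mathbb{R}^n$ containing the origin in its interior, and assume that the fan $\Sigma_P$ of cones over the proper faces of $P$ is simplicial. Let $\delta_P(z)=\delta_0+\delta_1z+\cdots+\delta_nz^n$ be its $\delta$-vector and $\operatorname{Spec}_P(z)$ its Newton spectrum. Then the following are equivalent: 1. $\operatorname{Spec}_P(z)$ is a polynomial in $z$ (i.e. all exponents of $z$ occurring in it are integers); 2. $P$ is reflexive; 3. $\operatorname{Spec}_P(z)=\delta_P(z)=\delta_0+\delta_1z+\cdots+\delta_nz^n$.
   Context: Put $N=\mathbb{Z}^n$ with dual lattice $M$ and canonical pairing $\langle\ ,\ \rangle$. A lattice polytope is the convex hull of a finite subset of $N$. The polar polytope of $P$ is $P^\circ:=\{y\in M_{\mathbb{R}}\mid\langle y,x\rangle\le1\ \text{for all}\ x\in P\}$. A lattice polytope $P$ is reflexive if it contains the origin as an interior point and $P^\circ$ is a lattice polytope (its vertices lie in $M$). Newton function: $\nu:\mathbb{R}^n\to\mathbb{R}$ is the function taking the value $1$ at the vertices of $P$ and linear on each cone of the fan $\Sigma_P$ formed by the cones over the proper faces of $P$. Equivalently, $\nu(v)=\max_F\langle u_F,v\rangle$, the maximum being over the facets $F$ of $P$, where $u_F\in M_{\mathbb{Q}}$ is such that $P\subset\{\langle u_F,x\rangle\le1\}$ and $F=P\cap\{\langle u_F,x\rangle=1\}$. Newton spectrum: $\operatorname{Spec}_P(z):=(1-z)^n\sum_{v\in N}z^{\nu(v)}$, a formal series in $z$ with nonnegative rational exponents (an element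 of $\mathbb{Z}[[z^{1/d}]]$ for a suitable integer $d\ge1$); it is in fact a finite sum $\sum_{i=1}^{\mu_P}z^{\beta_i}$ with $\beta_i\in\mathbb{Q}\cap[0,n]$ and $\mu_P=n!\operatorname{vol}(P)$. $\delta$-vector: with $L_P(m):=\operatorname{Card}(mP\cap N)$, the $\delta$-vector $\delta_P(z)=\delta_0+\cdots+\delta_nz^n$ of $P$ is the polynomial defined by $$1+\sum_{m\ge1}L_P(m)z^m=\frac{\delta_0+\delta_1z+\cdots+\delta_nz^n}{(1-z)^{n+1}}.$$ *)

(* Defs.v *)
From HB Require Import structures.
From mathcomp Require Import all_boot all_order all_algebra.
From mathcomp Require Import finmap.
From mathcomp Require Import all_classical all_reals topology normedtype.

Set Implicit Arguments.
Unset Strict Implicit.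
Unset Printing Implicit Defensive.

Import Order.TTheory GRing.Theory Num.Theory.
Import numFieldNormedType.Exports.

Local Open Scope classical_set_scope.
Local Open Scope ring_scope.

Section Polytopes.
Context {R : realType} {n : nat}.
Implicit Types (A P F C : set 'rV[R]_n) (u v w x y : 'rV[R]_n).

(* Both N and its dual M are identified with 'rV[int]_n, the canonical pairing
   being the standard one. *)
Definition pairing u v : R := (u *m v^T) 0 0.

Definition of_lattice (w : 'rV[int]_n) : 'rV[R]_n := map_mx intr w.

Definition convex_hull A : set 'rV[R]_n :=
  [set v | exists k (a : 'I_k -> 'rV[R]_n) (t : 'I_k -> R),
    [/\ forall i, A (a i), forall i, 0 <= t i,
        \sum_(i < k) t i = 1 & v = \sum_(i < k) t i *: a i]].

(* Contains 0 even if A is empty (take k = 0), so that the cone over the empty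
   face is {0}. *)
Definition cone_over A : set 'rV[R]_n :=
  [set v | exists k (a : 'I_k -> 'rV[R]_n) (t : 'I_k -> R),
    [/\ forall i, A (a i), forall i, 0 <= t i
      & v = \sum_(i < k) t i *: a i]].

Definition lattice_polytope P : Prop :=
  exists S : seq 'rV[int]_n, P = convex_hull (of_lattice @` [set` S]).

Definition full_dimensional P : Prop :=
  forall u (c : R), (forall x, P x -> pairing u x = c) -> u = 0.

Definition polar P : set 'rV[R]_n :=
  [set y | forall x, P x -> pairing y x <= 1].

Definition reflexive_polytope P : Prop :=
  [/\ lattice_polytope P, interior P 0 & lattice_polytope (polar P)].

Definition face P F : Prop :=
  exists u (c : R), (forall x, P x -> pairing u x <= c) /\
    F = P `&` [set x | pairing u x = c].

Definition proper_face P F : Prop := face P F /\ F <> P.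

Definition vertex P v : Prop := face P [set v].

Definition simplicial_cone C : Prop :=
  exists k (B : 'M[R]_(k, n)), row_free B /\ C = cone_over (range (fun i => row i B)).

Definition simplicial_fan P : Prop :=
  forall F, proper_face P F -> simplicial_cone (cone_over F).

Definition is_newton_function P (nu : 'rV[R]_n -> R) : Prop :=
  (forall v, vertex P v -> nu v = 1) /\
  (forall F, proper_face P F ->
     exists u, forall v, cone_over F v -> nu v = pairing u v).

(* For n > 0 and P a polytope with 0 in its interior, the Newton function exists
   and is unique.  The default value only matters for n = 0, where the vertex of
   P is the origin; it gives the expected nu = 0. *)
Definition newton P : 'rV[R]_n -> R :=
  xget (fun=> 0) [set nu | is_newton_function P nu].

(* Card (m P \cap N); fset_set is the given set when it is finite, as here. *)
Definition lattice_count P (m : nat) : nat :=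
  #|` fset_set [set w : 'rV[int]_n |
        ((fun x => m%:R *: x) @` P) (of_lattice w)]|.

End Polytopes.

(* A formal series in z with real exponents is represented by its function of
   coefficients: f a is the coefficient of z^a. *)
Definition gseries (R : realType) := R -> int.

Section GeneralizedSeries.
Context {R : realType}.

Definition gseries_of_poly (p : {poly int}) : gseries R :=
  fun a => \sum_(i < size p) p`_i * (a == i%:R)%:R.

Definition gseries_of_nat (f : nat -> int) : gseries R :=
  fun a => if a \is a Num.nat then f (Num.truncn a) else 0.

Definition poly_mul_gseries (p : {poly int}) (f : gseries R) : gseries R :=
  fun a => \sum_(i < size p) p`_i * f (a - i%:R).

End GeneralizedSeries.

Section SpectrumAndDelta.
Context {R : realType} {n : nat}.
Implicit Type P : set 'rV[R]_n.

(* The sum of the z^(nu v) for v in N: only finitely many lattice points have a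
   given value under nu. *)
Definition newton_series P : gseries R :=
  fun a => (#|` fset_set [set w : 'rV[int]_n | newton P (of_lattice w) = a]|)%:Z.

Definition newton_spectrum P : gseries R :=
  poly_mul_gseries ((1 - 'X) ^+ n) (newton_series P).

Definition ehrhart_series P : gseries R :=
  gseries_of_nat (fun m => if m == 0%N then 1 else (lattice_count P m)%:Z).

(* The defining identity of the delta-vector, multiplied by (1 - z)^(n + 1),
   which is invertible in Z[[z]]. *)
Definition is_delta_vector P (delta : {poly int}) : Prop :=
  (size delta <= n.+1)%N /\
  poly_mul_gseries ((1 - 'X) ^+ n.+1) (ehrhart_series P)
    = gseries_of_poly delta.

End SpectrumAndDelta.

(* Main.v *)
Require Import Defs.
From HB Require Import structures.
From mathcomp Require Import all_boot all_order all_algebra.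
From mathcomp Require Import finmap.
From mathcomp Require Import all_classical all_reals topology normedtype.
From mathcomp Require Import ring zify.
Import numFieldNormedType.Exports.
Import Order.TTheory GRing.Theory Num.Theory.

(** Everything rests on one function, the gauge of [P]: the maximum of
    [pairing u v] over the polar of [P], equivalently the least [t >= 0] such
    that [v] lies in [t P].  It is the Newton function ([newtonE]).  A point in
    the cone over a proper face [F] is measured exactly by the functional of
    the polar equal to [1] on [F] ([gauge_on_cone]), so the gauge is linear on
    the cones of the fan and is [1] at the vertices; conversely each nonzero
    point lies in the cone over a proper face whose points are convex
    combinations of vertices, which leaves no choice.

    The claim reduces to this: [P] is reflexive if and only if the gauge is
    integral on the lattice.

    If the polar is the hull of lattice points, the maximum defining the gauge
    is reached at one of them, hence is an integer at lattice points
    ([reflexive_gauge_integral]).  In the other direction, the gauge at any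
    point is reached at some [u] in the polar equal to [1] on a spanning set of
    generators of [P], that is, at the normal of a facet
    ([gauge_attained_spanning]).  The gauge agrees with such a [u] on the cone
    over the facet, which contains a translate of any lattice vector by a
    lattice point; differences of gauge values then show that [u] is integral
    ([spanning_normal_integral]).  The polar is therefore the hull of its
    lattice points, any other point of it being cut off by a functional whose
    maximum on the polar is reached at an integral facet normal
    ([polar_lattice_polytope]).

    As to the series, multiplication by [(1 - z)^n] acts separately on each
    class of exponents modulo the integers and is injective on series whose
    exponents are bounded below, so a polynomial spectrum forces all values of
    the Newton function on the lattice to be integers
    ([gseries_integral_exponents]).  When they are, the number of lattice
    points of value [m] is [L(m) - L(m - 1)], hence the Newton series is
    [1 - z] times the Ehrhart series and the spectrum is the delta-vector. *)

Set Implicit Arguments.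
Unset Strict Implicit.
Unset Printing Implicit Defensive.

Local Open Scope ring_scope.

(** * The pairing *)

Section Pairing.
Local Open Scope classical_set_scope.
Context {R : realType} {n : nat}.
Implicit Types u v w : 'rV[R]_n.

Lemma pairingE u v : pairing u v = \sum_j u 0 j * v 0 j.
Proof. by rewrite /pairing mxE; apply: eq_bigr => j _; rewrite mxE. Qed.

Lemma pairingC u v : pairing u v = pairing v u.
Proof. by rewrite !pairingE; apply: eq_bigr => j _; rewrite mulrC. Qed.

Lemma pairingDl u v w : pairing (u + v) w = pairing u w + pairing v w.
Proof. by rewrite /pairing mulmxDl mxE. Qed.

Lemma pairingZl (c : R) u w : pairing (c *: u) w = c * pairing u w.
Proof. by rewrite /pairing -scalemxAl mxE. Qed.

Lemma pairingDr u v w : pairing w (u + v) = pairing w u + pairing w v.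
Proof. by rewrite !(pairingC w) pairingDl. Qed.

Lemma pairingZr (c : R) u w : pairing w (c *: u) = c * pairing w u.
Proof. by rewrite !(pairingC w) pairingZl. Qed.

Lemma pairing0l v : pairing 0 v = 0.
Proof. by rewrite /pairing mul0mx mxE. Qed.

Lemma pairing0r v : pairing v 0 = 0.
Proof. by rewrite pairingC pairing0l. Qed.

Lemma pairingNr u v : pairing u (- v) = - pairing u v.
Proof. by rewrite -scaleN1r pairingZr mulN1r. Qed.

Lemma pairingNl u v : pairing (- u) v = - pairing u v.
Proof. by rewrite pairingC pairingNr pairingC. Qed.

Lemma pairing_sumr k (a : 'I_k -> 'rV[R]_n) (t : 'I_k -> R) u :
  pairing u (\sum_i t i *: a i) = \sum_i t i * pairing u (a i).
Proof.
elim/big_rec2: _ => [|i s v _ <-]; first by rewrite pairing0r.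
by rewrite pairingDr pairingZr.
Qed.

Lemma pairing_delta u j : pairing u (delta_mx 0 j) = u 0 j.
Proof.
rewrite pairingE (bigD1 j) //= mxE !eqxx mulr1 big1 ?addr0 // => i /negPf ij.
by rewrite mxE ij andbF mulr0.
Qed.

Lemma pairing_self_ge0 v : 0 <= pairing v v.
Proof. by rewrite pairingE; apply: sumr_ge0 => j _; rewrite -expr2 sqr_ge0. Qed.

Lemma pairing_self_gt0 v : v != 0 -> 0 < pairing v v.
Proof.
rewrite lt_neqAle pairing_self_ge0 andbT; apply: contra; rewrite eq_sym => /eqP.
rewrite pairingE => /psumr_eq0P v0; apply/eqP/rowP => j; rewrite mxE.
apply/eqP; rewrite -sqrf_eq0 expr2; apply/eqP/v0 => // i _.
by rewrite -expr2 sqr_ge0.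
Qed.

End Pairing.

(** * Farkas lemma *)

Section Farkas.
Context {R : realType} {n : nat}.

(** Induction on the number of generators, after Bartl.  If dropping the
    generator [a ord0] breaks the hypothesis, some [x0] witnesses it, and
    [a ord0] is positive at [x0]; subtracting from all vectors the multiple of
    [a ord0] that makes them vanish at [x0] restores the hypothesis for the
    remaining generators. *)
Lemma farkas k (a : 'I_k -> 'rV[R]_n) (b : 'rV[R]_n) :
  (forall x, (forall i, pairing (a i) x <= 0) -> pairing b x <= 0) ->
  exists t : 'I_k -> R, (forall i, 0 <= t i) /\ b = \sum_i t i *: a i.
Proof.
elim: k a b => [|k IH] a b ab.
  exists (fun=> 0); split=> //; rewrite big_ord0; apply/eqP.
  apply/negPn/negP => /pairing_self_gt0; rewrite ltNge => /negP; apply.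
  by apply: ab; case.
pose a' i := a (lift ord0 i).
have [a'b|/existsNP[x0]] := pselect
    (forall x, (forall i, pairing (a' i) x <= 0) -> pairing b x <= 0).
  have [t [t0 ->]] := IH _ _ a'b.
  exists (fun i => if unlift ord0 i is Some j then t j else 0); split=> [i|].
    by case: unlift => [j|//]; apply: t0.
  rewrite big_ord_recl unlift_none scale0r add0r; apply: eq_bigr => i _.
  by rewrite liftK.
move/not_implyP => -[a'x0 /negP]; rewrite -ltNge => bx0.
have ax0 : 0 < pairing (a ord0) x0.
  rewrite ltNge; apply/negP => a0; move: bx0; rewrite ltNge => /negP; apply.
  by apply: ab => i; case: (unliftP ord0 i) => [j ->|-> //]; apply: a'x0.
pose s := (pairing (a ord0) x0)^-1.
have s0 : 0 < s by rewrite invr_gt0.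
pose proj v := v - (s * pairing v x0) *: a ord0.
have projE v x : pairing (proj v) x =
    pairing v (x - (s * pairing (a ord0) x) *: x0).
  by rewrite /proj pairingDl pairingNl pairingZl pairingDr pairingNr pairingZr;
    ring.
have [x abx|t [t0 tb]] := IH (proj \o a') (proj b).
  rewrite projE; apply: ab => i; case: (unliftP ord0 i) => [j ->|->].
    by rewrite -projE; apply: abx.
  rewrite pairingDr pairingNr pairingZr mulrAC /s mulVf ?gt_eqF // mul1r.
  by rewrite subrr.
exists (fun i => if unlift ord0 i is Some j then t j
  else s * (pairing b x0 - \sum_j t j * pairing (a' j) x0)); split.
  move=> i; case: unlift => [j|]; [exact: t0|apply: mulr_ge0; first exact: ltW].
  rewrite subr_ge0 (le_trans _ (ltW bx0)) //; apply: sumr_le0 => j _.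
  by apply: mulr_ge0_le0.
rewrite big_ord_recl unlift_none.
under [X in _ = _ + X]eq_bigr do rewrite liftK.
transitivity (proj b + (s * pairing b x0) *: a ord0); first by rewrite subrK.
rewrite tb /= /proj.
under eq_bigr do rewrite scalerBr.
rewrite sumrB mulrBr scalerBl [RHS]addrC -addrA; congr (_ + _).
rewrite [LHS]addrC; congr (_ - _).
rewrite mulr_sumr scaler_suml.
by apply: eq_bigr => i _; rewrite scalerA; congr (_ *: _); ring.
Qed.

End Farkas.

(** * Separation, faces and vertices of finite convex hulls *)

Section ConvexHull.
Local Open Scope classical_set_scope.
Context {R : realType} {n : nat}.
Implicit Types (A B : set 'rV[R]_n) (u v x y b : 'rV[R]_n).
Implicit Types V W : seq 'rV[R]_n.

Lemma sub_convex_hull A : A `<=` convex_hull A.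
Proof.
move=> x Ax; exists 1%N, (fun=> x), (fun=> 1).
by split=> //; rewrite big_ord1 // scale1r.
Qed.

Lemma sub_cone_over A : A `<=` cone_over A.
Proof.
move=> x Ax; exists 1%N, (fun=> x), (fun=> 1).
by split=> //; rewrite big_ord1 // scale1r.
Qed.

Lemma cone_over_origin A : cone_over A 0.
Proof.
by exists 0%N, (fun=> 0), (fun=> 0); split=> //; rewrite ?big_ord0 //; case.
Qed.

Lemma convex_hullS A B : A `<=` B -> convex_hull A `<=` convex_hull B.
Proof.
by move=> AB x [k [a [t [Aa t0 t1 ->]]]]; exists k, a, t; split=> // i; apply: AB.
Qed.

Lemma pairing_convex_hull_le A u (c : R) :
  (forall x, A x -> pairing u x <= c) ->
  forall x, convex_hull A x -> pairing u x <= c.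
Proof.
move=> Ac x [k [a [t [Aa t0 t1 ->]]]]; rewrite pairing_sumr.
rewrite -[c]mul1r -t1 mulr_suml; apply: ler_sum => i _.
by apply: ler_wpM2l => //; apply: Ac.
Qed.

(** A convex combination reaches the maximum of a functional only if each term
    of positive weight does. *)
Lemma convex_hull_face A u (c : R) :
  (forall x, A x -> pairing u x <= c) ->
  forall x, convex_hull A x -> pairing u x = c ->
  convex_hull (A `&` [set y | pairing u y = c]) x.
Proof.
move=> Ac x [k [a [t [Aa t0 t1 ->]]]]; rewrite pairing_sumr => uc.
have slack i : t i * (c - pairing u (a i)) = 0.
  apply: (psumr_eq0P (P := xpredT) (F := fun i => t i * (c - pairing u (a i)))) => //.
    by move=> j _; rewrite mulr_ge0 // subr_ge0 Ac.
  under eq_bigr do rewrite mulrBr.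
  by rewrite sumrB uc -mulr_suml t1 mul1r subrr.
have onface i : t i != 0 -> pairing u (a i) = c.
  move=> ti; apply/esym/eqP; rewrite -subr_eq0; apply/eqP.
  by apply: (mulfI ti); rewrite slack mulr0.
have [i0 ti0] : exists i, t i != 0.
  apply/not_existsP => tz; move: t1; rewrite big1 => [/eqP|i _].
    by rewrite eq_sym oner_eq0.
  by apply/eqP/negPn/negP/tz.
(* Points of weight 0 may lie off the face; they are moved to the point i0. *)
exists k, (fun i => if t i == 0 then a i0 else a i), t; split=> // [i|].
  by case: eqP => [_|/eqP ti]; split=> //; apply: onface.
by apply: eq_bigr => i _; case: eqP => // ->; rewrite !scale0r.
Qed.

(** Farkas lemma one dimension higher, where each [v] becomes [(v, 1)]: the
    last coordinate turns conical combinations into convex ones. *)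
Lemma convex_hull_separation V b : ~ convex_hull [set` V] b ->
  exists u (c : R), (forall x, x \in V -> pairing u x <= c) /\ c < pairing u b.
Proof.
move=> Vb; apply: contrapT => nosep; apply: Vb.
pose lift1 v : 'rV[R]_(n + 1) := row_mx v (const_mx 1).
have lift1E v (x : 'rV[R]_(n + 1)) :
    pairing (lift1 v) x = pairing (lsubmx x) v + rsubmx x 0 0.
  rewrite (pairingC (lsubmx x)) -{1}(hsubmxK x) /pairing tr_row_mx mul_row_col.
  by rewrite !mxE big_ord1 !mxE mul1r.
have [x Vx|t [t0 tb]] :=
    @farkas R (n + 1) (size V) (fun i => lift1 (tnth (in_tuple V) i)) (lift1 b).
  rewrite leNgt; apply/negP => bx; apply: nosep.
  exists (lsubmx x), (- rsubmx x 0 0); split=> [v /(tnthP (in_tuple V))[i ->]|].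
    by rewrite -subr_ge0 -opprD oppr_ge0 addrC -lift1E; apply: Vx.
  by rewrite -subr_gt0 opprK -lift1E.
exists (size V), (tnth (in_tuple V)), t; split=> //.
- by move=> i; rewrite /= mem_tnth.
- have /(congr1 (fun M : 'rV[R]_(n + 1) => M 0 (rshift n 0))) := tb.
  rewrite summxE row_mxEr mxE => ->.
  by apply: eq_bigr => i _; rewrite mxE row_mxEr mxE mulr1.
- apply/rowP => j.
  have /(congr1 (fun M : 'rV[R]_(n + 1) => M 0 (lshift 1 j))) := tb.
  rewrite !summxE row_mxEl => ->.
  by apply: eq_bigr => i _; rewrite mxE row_mxEl [RHS]mxE.
Qed.

Lemma vertex_convex_hull V x u (c : R) : x \in V ->
  (forall y, y \in rem x V -> pairing u y <= c) -> c < pairing u x ->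
  vertex (convex_hull [set` V]) x.
Proof.
move=> xV Vc cx.
have lt_ux y : y \in V -> y != x -> pairing u y < pairing u x.
  by move=> yV yx; apply: le_lt_trans cx; apply/Vc/rem_mem.
have le_ux y : [set` V] y -> pairing u y <= pairing u x.
  by move=> yV; have [->//|/(lt_ux _ yV)/ltW] := eqVneq y x.
exists u, (pairing u x); split; first exact: pairing_convex_hull_le.
apply/seteqP; split=> [_ ->|y [/(convex_hull_face le_ux) Vy uy]].
  by split=> //; apply: sub_convex_hull.
have [k [a [t [aV _ t1 ->]]]] := Vy uy.
have ax i : a i = x.
  have [aiV /= aix] := aV i; apply/eqP/negPn/negP => /(lt_ux _ aiV).
  by rewrite aix ltxx.
by under eq_bigr do rewrite ax; rewrite -scaler_suml t1 scale1r.
Qed.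

(** As long as some element of the list is in the hull of the others, it is
    dropped.  In the list that remains, each element is separated from the hull
    of the others, hence is exposed. *)
Lemma convex_hull_vertices V : exists W, [/\ {subset W <= V},
  convex_hull [set` W] = convex_hull [set` V] &
  forall x, x \in W -> vertex (convex_hull [set` V]) x].
Proof.
have [m] := ubnP (size V); elim: m V => // m IH V /ltnSE sV.
have [[x [xV Vx]]|irr] :=
    pselect (exists x, x \in V /\ convex_hull [set` rem x V] x).
  have remV : convex_hull [set` rem x V] = convex_hull [set` V].
    apply/seteqP; split; first by apply: convex_hullS => y /mem_rem.
    move=> y Vy; apply: contrapT => /convex_hull_separation[u [c [Vc]]].
    rewrite ltNge => /negP; apply; apply: pairing_convex_hull_le Vy => z /= zV.
    have [->|zx] := eqVneq z x; last exact/Vc/rem_mem.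
    exact: pairing_convex_hull_le Vx.
  have [|W [WV WE Wv]] := IH (rem x V).
    by rewrite size_rem //; case: (V) xV sV.
  exists W; split; last by rewrite -remV.
    by move=> y /WV /mem_rem.
  by rewrite WE.
exists V; split=> // x xV.
have [|u [c [Vc cx]]] := @convex_hull_separation (rem x V) x.
  by move=> Vx; apply: irr; exists x.
exact: (vertex_convex_hull xV Vc cx).
Qed.

End ConvexHull.

(** * The gauge and the Newton function *)

(** The support function of the polar.  For a polytope with the origin in its
    interior it is the Minkowski functional of [P], see [gauge_le_dilate]. *)
Definition gauge {R : realType} {n : nat} (P : set 'rV[R]_n) (v : 'rV[R]_n) : R :=
  sup [set pairing u v | u in polar P]%classic.

Lemma seq_bounded {R : realType} (T : eqType) (f : T -> R) (s : seq T) :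
  exists2 M, 0 < M & forall x, x \in s -> f x <= M.
Proof.
elim: s => [|x s [M M0 sM]]; first by exists 1.
exists (Num.max M (f x)); first by rewrite lt_max M0.
by move=> y; rewrite inE le_max => /orP[/eqP->|/sM->//]; rewrite lexx orbT.
Qed.

Section Gauge.
Local Open Scope classical_set_scope.
Context {R : realType} {n : nat} (V : seq 'rV[R]_n).
Let P := convex_hull [set` V].
Context (P0 : interior P 0).
Implicit Types (F : set 'rV[R]_n) (u v w x y : 'rV[R]_n).

Lemma polytope_absorbing w : exists2 e : R, 0 < e & P (e *: w).
Proof.
have /nbhs_ballP[r /= r0 Pr] := P0.
have [M M0 wM] := seq_bounded (fun j => `|w 0 j|) (enum 'I_n).
exists (r / (2 * M)); first by rewrite divr_gt0 // mulr_gt0.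
apply: Pr; split=> // i j; rewrite (ord1 i) !mxE /ball /= sub0r normrN normrM.
rewrite gtr0_norm ?divr_gt0 ?mulr_gt0 // mulrAC ltr_pdivrMr ?mulr_gt0 //.
rewrite ltr_pM2l // (le_lt_trans (wM j _)) ?mem_enum //.
by rewrite ltr_pMl // ltr1n.
Qed.

Lemma origin_in_polytope : P 0.
Proof. by have [e _] := polytope_absorbing 0; rewrite scaler0. Qed.

Lemma polar_generators y : (forall x, x \in V -> pairing y x <= 1) -> polar P y.
Proof. by move=> yV x; apply: pairing_convex_hull_le. Qed.

Lemma generator_in_polytope x : x \in V -> P x.
Proof. by move=> xV; apply: sub_convex_hull. Qed.

Lemma polar0 : polar P 0.
Proof. by move=> x _; rewrite pairing0l ler01. Qed.

Lemma polar_absorbing w : exists2 e : R, 0 < e & polar P (e *: w).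
Proof.
have [M M0 wM] := seq_bounded (pairing w) V.
exists M^-1; first by rewrite invr_gt0.
by apply: polar_generators => x xV; rewrite pairingZl mulrC ler_pdivrMr // mul1r wM.
Qed.

(** The interior point [0] has points of [P] on both sides of any hyperplane
    through it, so no such hyperplane supports [P]. *)
Lemma support_height_gt0 u (c : R) :
  (forall x, P x -> pairing u x <= c) -> u != 0 -> 0 < c.
Proof.
move=> uc u0; have [e e0 /uc] := polytope_absorbing u.
by apply: lt_le_trans; rewrite pairingZr mulr_gt0 // pairing_self_gt0.
Qed.

(** A hyperplane separating [x] from [P] has positive height, and can be scaled
    to an element of the polar. *)
Lemma bipolar x : (forall u, polar P u -> pairing u x <= 1) -> P x.
Proof.
move=> ux; apply: contrapT => /convex_hull_separation[u [c [Vc cx]]].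
have uP : forall y, P y -> pairing u y <= c by exact: pairing_convex_hull_le.
have u0 : u != 0.
  apply: contraPneq (uP 0 origin_in_polytope) => u0.
  by move: cx; rewrite u0 !pairing0l => c0 /(lt_le_trans c0); rewrite ltxx.
have c0 := support_height_gt0 uP u0.
have /ux : polar P (c^-1 *: u).
  by move=> y /uP uy; rewrite pairingZl mulrC ler_pdivrMr ?mul1r.
by rewrite pairingZl mulrC ler_pdivrMr // mul1r leNgt cx.
Qed.

Lemma polar_bounded v : has_ubound [set pairing u v | u in polar P].
Proof.
have [e e0 Pev] := polytope_absorbing v.
exists e^-1 => _ [u /(_ _ Pev) uv <-]; move: uv.
by rewrite pairingZr -ler_pdivlMl // mulr1.
Qed.

Lemma pairing_le_gauge u v : polar P u -> pairing u v <= gauge P v.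
Proof. by move=> Pu; apply: ub_le_sup (polar_bounded v) _ _; exists u. Qed.

Lemma gauge_le v (c : R) :
  (forall u, polar P u -> pairing u v <= c) -> gauge P v <= c.
Proof.
move=> vc; apply: ge_sup; first by exists (pairing 0 v), 0 => //; exact: polar0.
by move=> _ [u Pu <-]; apply: vc.
Qed.

Lemma gauge_ge0 v : 0 <= gauge P v.
Proof. by rewrite -(pairing0l v); apply: pairing_le_gauge polar0. Qed.

Lemma gauge_gt0 v : v != 0 -> 0 < gauge P v.
Proof.
move=> v0; have [e e0 /(pairing_le_gauge v)] := polar_absorbing v.
by apply: lt_le_trans; rewrite pairingZl mulr_gt0 // pairing_self_gt0.
Qed.

Lemma gauge0 : gauge P 0 = 0.
Proof.
apply/eqP; rewrite eq_le gauge_ge0 andbT.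
by apply: gauge_le => u _; rewrite pairing0r.
Qed.

Lemma gauge_eq0 v : (gauge P v == 0) = (v == 0).
Proof.
by have [->|/gauge_gt0/gt_eqF//] := eqVneq v 0; rewrite gauge0 eqxx.
Qed.

Lemma gauge_le_dilate v (t : R) : 0 <= t ->
  gauge P v <= t <-> exists2 x, P x & t *: x = v.
Proof.
move=> t0; split=> [vt|[x Px <-]]; last first.
  by apply: gauge_le => u /(_ _ Px) ux; rewrite pairingZr -[leRHS]mulr1 ler_wpM2l.
have [tz|tn0] := eqVneq t 0.
  have /eqP v0 : v == 0 by rewrite -gauge_eq0 eq_le gauge_ge0 andbT -tz.
  by exists 0; [exact: origin_in_polytope|rewrite v0 scaler0].
have tp : 0 < t by rewrite lt_neqAle eq_sym tn0.
exists (t^-1 *: v); last by rewrite scalerA mulfV // scale1r.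
apply: bipolar => u Pu; rewrite pairingZr mulrC ler_pdivrMr // mul1r.
exact: le_trans (pairing_le_gauge _ Pu) vt.
Qed.

(** Linear programming duality.  Write [g] for the gauge of [v].  By Farkas
    lemma for the vectors [g s - v], with [s] a generator, either some [u]
    positive at [v] satisfies [g * pairing u s <= pairing u v] for all [s], and
    a multiple of it is a maximizer, or [v] lies in a dilate of [P] smaller
    than [g P]. *)
Lemma gauge_attained v : exists2 u, polar P u & pairing u v = gauge P v.
Proof.
have [->|v0] := eqVneq v 0.
  by exists 0; [exact: polar0|rewrite pairing0r gauge0].
have g0 := gauge_gt0 v0; set g := gauge P v in g0 *.
pose a i := g *: tnth (in_tuple V) i - v.
have [|nocert] := pselect
    (forall x, (forall i, pairing (a i) x <= 0) -> pairing v x <= 0).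
  (* v = sum_i t_i (g s_i - v) would put v in c P with c = g T / (1 + T) < g,
     where T is the sum of the t_i. *)
  move=> /farkas[t [t0 vt]]; pose T := \sum_i t i.
  have T0 : 0 <= T by apply: sumr_ge0.
  have T1 : 0 < 1 + T by rewrite ltr_wpDr.
  suff : g <= (g * T) / (1 + T).
    by rewrite ler_pdivlMr // mulrDr mulr1 gerDr leNgt g0.
  apply: gauge_le => u Pu; rewrite ler_pdivlMr // mulrDr mulr1.
  rewrite -lerBrDr {1}vt pairing_sumr -subr_ge0.
  have -> : g * T - pairing u v * T -
      \sum_i t i * pairing u (a i) = 
      \sum_i t i * (g * (1 - pairing u (tnth (in_tuple V) i))).
    rewrite -mulrBl mulr_sumr -sumrB; apply: eq_bigr => i _.
    by rewrite /a pairingDr pairingNr pairingZr; ring.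
  apply: sumr_ge0 => i _; rewrite !mulr_ge0 // ?(ltW g0) // subr_ge0.
  by apply: Pu; apply: generator_in_polytope; apply: mem_tnth.
have [u [au /negP]] : exists u, (forall i, pairing (a i) u <= 0) /\
    ~ (pairing v u <= 0).
  apply: contrapT => nou; apply: nocert => x ax; apply: contrapT => vx.
  by apply: nou; exists x.
rewrite -ltNge pairingC => uv.
exists ((g / pairing u v) *: u); last by rewrite pairingZl divfK // gt_eqF.
apply: polar_generators => x /(tnthP (in_tuple V))[i ->].
rewrite pairingZl mulrAC ler_pdivrMr // mul1r -subr_le0.
by have := au i; rewrite pairingC /a pairingDr pairingNr pairingZr.
Qed.

(** The weights of [v] on points of [F] add up to [pairing u v], and bound all
    functionals of the polar at [v]. *)
Lemma gauge_on_cone F u v : polar P u ->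
  (forall x, F x -> P x /\ pairing u x = 1) ->
  cone_over F v -> gauge P v = pairing u v.
Proof.
move=> Pu Fu [k [a [t [Fa t0 ->]]]]; apply/eqP; rewrite eq_le.
rewrite pairing_le_gauge // andbT; apply: gauge_le => y Py; rewrite !pairing_sumr.
apply: ler_sum => i _; have [Pa ->] := Fu _ (Fa i).
by apply: ler_wpM2l => //; apply: Py.
Qed.

Lemma proper_face_normal F : proper_face P F ->
  exists2 u, polar P u & forall x, F x -> P x /\ pairing u x = 1.
Proof.
move=> [[u [c [uc FE]]] FP].
have [u0|u0] := eqVneq u 0.
  exists 0; first exact: polar0.
  move=> x; rewrite {1}FE u0 /= pairing0l => -[_ c0]; case: FP.
  by rewrite FE; apply/seteqP; split=> [y []|y Py] //; split; rewrite //= u0 pairing0l.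
have c0 := support_height_gt0 uc u0.
exists (c^-1 *: u).
  by move=> y /uc uy; rewrite pairingZl mulrC ler_pdivrMr ?mul1r.
by move=> x; rewrite FE => -[Px /= ux]; rewrite pairingZl ux mulVf // gt_eqF.
Qed.

Lemma vertex_proper_face v : (0 < n)%N -> vertex P v -> proper_face P [set v].
Proof.
move=> n0 Pv; split=> // vP; pose j := Ordinal n0.
have Pz x : P x -> x = v by rewrite -vP.
have [e e0 /Pz] := polytope_absorbing (delta_mx 0 j).
rewrite -(Pz _ origin_in_polytope) => /(congr1 (fun x : 'rV[R]_n => x 0 j)).
by rewrite !mxE !eqxx mulr1 => ez; rewrite ez ltxx in e0.
Qed.

Lemma gauge_is_newton_function : (0 < n)%N -> is_newton_function P (gauge P).
Proof.
move=> n0; split=> [v /(vertex_proper_face n0)|F] /proper_face_normal[u Pu Fu].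
  rewrite (gauge_on_cone Pu Fu); last exact: sub_cone_over.
  by have [] := Fu v.
by exists u => v; apply: gauge_on_cone.
Qed.

Context (vertexV : forall x, x \in V -> vertex P x).

(** If [u] realizes the gauge of [v], then [v] lies in the cone over the face
    of [P] on which [u] is [1], and even in the cone over the vertices of that
    face; there the value of a Newton function is the sum of the weights. *)
Lemma newton_function_unique nu : is_newton_function P nu -> nu = gauge P.
Proof.
move=> [nu1 nuF]; apply/funext => v.
have [u Pu uv] := gauge_attained v.
pose F := P `&` [set x | pairing u x = 1].
have PF : proper_face P F.
  split; first by exists u, 1; split.
  move=> FP; have := origin_in_polytope; rewrite -FP => -[_ /= /eqP].
  by rewrite pairing0r eq_sym oner_eq0.
have [w nuw] := nuF F PF.
have [v0|v0] := eqVneq v 0.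
  by rewrite v0 nuw ?pairing0r ?gauge0 //; exact: cone_over_origin.
have g0 := gauge_gt0 v0.
have [x Px xv] := (gauge_le_dilate v (ltW g0)).1 (lexx _).
have ux : pairing u x = 1.
  by apply: (mulfI (lt0r_neq0 g0)); rewrite -pairingZr xv uv mulr1.
have [//|k [a [t [aF t0 t1 xE]]]] := @convex_hull_face _ _ [set` V] u 1 _ x Px ux.
  by move=> y yV; apply: Pu; apply: generator_in_polytope.
have Fa i : F (a i) by have [aV ua] := aF i; split=> //; apply: generator_in_polytope.
have wa i : pairing w (a i) = 1.
  by rewrite -nuw; [apply/nu1/vertexV; case: (aF i)|exact: sub_cone_over].
have vE : v = \sum_i (gauge P v * t i) *: a i.
  rewrite -{1}xv xE scaler_sumr; by apply: eq_bigr => i _; rewrite scalerA.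
rewrite nuw; last first.
  exists k, a, (fun i => gauge P v * t i); split=> // i.
  by rewrite mulr_ge0 // ltW.
rewrite {1}vE pairing_sumr; under eq_bigr do rewrite wa mulr1.
by rewrite -mulr_sumr t1 mulr1.
Qed.

Lemma newtonE : newton P = gauge P.
Proof.
rewrite /newton; have [n0|n0] := posnP n; last first.
  apply: newton_function_unique; apply: xgetPex.
  by exists (gauge P); apply: gauge_is_newton_function.
have v0 v : v = 0 by apply/rowP; move=> j; have := ltn_ord j; rewrite {2}n0.
(* The origin is a vertex and lies in the cone over the empty face, where a
   Newton function would be both 1 and 0. *)
rewrite xgetPN; first by apply/funext => v; rewrite (v0 v) gauge0.
move=> nu; move=> [nu1 nuF].
have [|w nuw] := nuF set0.
  split; last by move=> PE; have := origin_in_polytope; rewrite -PE.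
  exists 0, 1; split=> [x _|]; first by rewrite pairing0l.
  apply/seteqP; split=> // x [_ /= /eqP].
  by rewrite pairing0l eq_sym oner_eq0.
have := nuw 0 (cone_over_origin _); rewrite pairing0r nu1.
  by move/eqP; rewrite oner_eq0.
exists 0, 0; split=> [x _|]; first by rewrite pairing0l.
apply/seteqP; split=> [_ ->|x _]; last exact: v0.
by split; [exact: origin_in_polytope|exact: pairing0l].
Qed.

End Gauge.

(** * Lattice points *)

Section Lattice.
Local Open Scope classical_set_scope.
Context {R : realType} {n : nat}.
Implicit Types (u v x y : 'rV[R]_n) (w z : 'rV[int]_n).

Lemma of_latticeD w z : of_lattice (w + z) = of_lattice w + of_lattice z :> 'rV[R]_n.
Proof. exact: map_mxD. Qed.

Lemma of_latticeMn (k : nat) w : of_lattice (w *+ k) = k%:R *: of_lattice w :> 'rV[R]_n.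
Proof.
by rewrite /of_lattice raddfMn scaler_nat.
Qed.

Lemma pairing_lattice w z : pairing (of_lattice w) (of_lattice z) \is a @Num.int R.
Proof.
rewrite pairingE; apply: rpred_sum => j _.
by rewrite !mxE rpredM // intr_int.
Qed.

Lemma lattice_sum k (a : 'I_k -> 'rV[R]_n) :
  (forall i, exists w, a i = of_lattice w) ->
  exists w, \sum_i a i = of_lattice w.
Proof.
move=> aL; elim/big_rec: _ => [|i x _ [w ->]].
  by exists 0; rewrite /of_lattice map_mx0.
by have [z ->] := aL i; exists (z + w); rewrite of_latticeD.
Qed.

(** Bounds on all functionals give bounds on the coordinates and on their
    opposites. *)
Lemma finite_lattice_set (A : set 'rV[int]_n) :
  (forall v, exists c : R, forall w, A w -> pairing (of_lattice w) v <= c) ->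
  finite_set A.
Proof.
move=> /choice[c Ac].
pose d j : 'rV[R]_n := delta_mx 0 j.
have [M M0 cM] := seq_bounded (fun j => Num.max (c (d j)) (c (- d j))) (enum 'I_n).
pose K := Num.Def.archi_bound M.
have AK w j : A w -> (`|w 0 j| <= K%:Z)%R.
  move=> Aw; rewrite -(ler_int R) intr_norm -pmulrn.
  have := cM j (mem_enum _ j); rewrite ge_max => /andP[c1 c2].
  have MK : M <= K%:R by rewrite ltW // archi_boundP // ltW.
  apply: le_trans MK; rewrite ler_norml.
  have wd : pairing (of_lattice w) (d j) = (w 0 j)%:~R.
    by rewrite pairing_delta mxE.
  rewrite -wd lerNl -pairingNr.
  by rewrite (le_trans (Ac _ _ Aw) c1) (le_trans (Ac _ _ Aw) c2).
pose f (g : {ffun 'I_n -> 'I_(K + K).+1}) : 'rV[int]_n := \row_j ((g j)%:Z - K%:Z).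
apply: (@sub_finite_set _ _ (f @` setT)); last exact/finite_image/finite_finset.
move=> w Aw; exists [ffun j => inord (absz (w 0 j + K%:Z))] => //.
apply/rowP => j; rewrite !mxE ffunE.
have := AK w j Aw; rewrite ler_norml => /andP[w1 w2].
by rewrite inordK; lia.
Qed.

End Lattice.

(** * Facet normals and the polar of a polytope with integral gauge *)

Section FacetNormals.
Local Open Scope classical_set_scope.
Context {R : realType} {n : nat} (V : seq 'rV[R]_n).
Let P := convex_hull [set` V].
Context (P0 : interior P 0).
Implicit Types (u v w x y : 'rV[R]_n).

(** Generators on which [u] is [1] span the whole space.  For [u] in the polar
    this makes [u] the normal of a facet, equivalently a vertex of the polar;
    the condition is stated on the orthogonal of these generators. *)
Definition spanning_normal u : Prop :=
  forall w, (forall x, x \in V -> pairing u x = 1 -> pairing w x = 0) -> w = 0.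

Lemma exists_generator_gt0 w : w != 0 -> exists2 x, x \in V & 0 < pairing w x.
Proof.
move=> w0; apply: contrapT => Vw.
suff /(support_height_gt0 P0)/(_ w0) : forall x, P x -> pairing w x <= 0.
  by rewrite ltxx.
apply: pairing_convex_hull_le => x xV; rewrite leNgt; apply/negP => wx.
by apply: Vw; exists x.
Qed.

(** Moving from [u] in the direction [w] keeps the generators where [u] is [1],
    as [w] vanishes there, and must leave the polar, as [w] is positive
    somewhere on [P].  It leaves when a new generator reaches the value [1]. *)
Lemma rotate_normal u w : polar P u -> w != 0 ->
  (forall x, x \in V -> pairing u x = 1 -> pairing w x = 0) ->
  exists e : R, [/\ 0 < e, polar P (u + e *: w) &
    exists2 x, x \in V & pairing (u + e *: w) x = 1 /\ pairing u x != 1].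
Proof.
move=> Pu w0 uw.
have Pu1 i : pairing u (tnth (in_tuple V) i) <= 1.
  by apply: Pu; apply: generator_in_polytope; apply: mem_tnth.
have [_ /(tnthP (in_tuple V))[i0 ->] wx0] := exists_generator_gt0 w0.
pose s i := tnth (in_tuple V) i.
pose ratio i := (1 - pairing u (s i)) / pairing w (s i).
have [i /= wi imin] := @arg_minP _ _ _ i0 (fun i => 0 < pairing w (s i)) ratio wx0.
have ui : pairing u (s i) != 1.
  by apply: contraTneq wi => /uw -> //; rewrite ?ltxx // mem_tnth.
exists (ratio i); split.
- by rewrite divr_gt0 // subr_gt0 lt_neqAle ui Pu1.
- apply: polar_generators => x /(tnthP (in_tuple V))[j ->].
  rewrite pairingDl pairingZl -lerBrDl.
  have [wj|wj] := ltP 0 (pairing w (s j)).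
    by rewrite -ler_pdivlMr //; apply: imin.
  apply: (@le_trans _ _ 0); last by rewrite subr_ge0 Pu1.
  by apply: mulr_ge0_le0 => //; rewrite divr_ge0 ?(ltW wi) // subr_ge0 Pu1.
- exists (s i); first exact: mem_tnth.
  by split=> //; rewrite pairingDl pairingZl divfK ?gt_eqF // addrC subrK.
Qed.

(** A maximizer that is [1] on as many generators as possible: if these did not
    span, moving it along their orthogonal would gain one more. *)
Lemma gauge_attained_spanning v :
  exists u, [/\ polar P u, pairing u v = gauge P v & spanning_normal u].
Proof.
have [u0 Pu0 u0v] := gauge_attained P0 v.
pose active u := count (fun x => pairing u x == 1) V.
have [m] := ubnP (size V - active u0).
elim: m u0 Pu0 u0v => // m IH u Pu uv /ltnSE um.
have [uspan|] := pselect (spanning_normal u); first by exists u.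
move=> /existsNP[w /not_implyP[uw /eqP w0]].
(* The direction w is oriented so that the pairing with v does not decrease. *)
wlog wv : w w0 uw / 0 <= pairing w v.
  move=> wlg; have [|/ltW wv] := leP 0 (pairing w v); first exact: wlg uw.
  apply: (wlg (- w)); rewrite ?oppr_eq0 ?pairingNl ?oppr_ge0 // => x xV ux.
  by rewrite pairingNl uw ?oppr0.
have [e [e0 Pue [y yV [uey uy]]]] := rotate_normal Pu w0 uw.
apply: (IH _ Pue).
  apply/eqP; rewrite eq_le (pairing_le_gauge P0 _ Pue) -uv pairingDl pairingZl lerDl.
  by rewrite mulr_ge0 // ltW.
have lt_active : (active u < active (u + e *: w)%R)%N.
  have sub x : x \in V -> pairing u x = 1 -> pairing (u + e *: w) x = 1.
    by move=> xV ux; rewrite pairingDl pairingZl uw // mulr0 addr0.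
  rewrite /active -!size_filter.
  have -> : [seq x <- V | pairing u x == 1] =
      [seq x <- [seq x <- V | pairing (u + e *: w) x == 1] | pairing u x == 1].
    rewrite -filter_predI; apply: eq_in_filter => x xV /=.
    by case: (eqVneq (pairing u x) 1) => // /(sub _ xV) ->; rewrite eqxx.
  rewrite [ltnLHS]size_filter ltn_neqAle count_size andbT -all_count.
  apply/negP => /allP/(_ y); rewrite mem_filter uey eqxx yV /= => /(_ isT).
  by rewrite (negPf uy).
apply: leq_trans um; rewrite ltn_sub2l //.
by apply: leq_trans lt_active _; exact: count_size.
Qed.

(** Let [s] be the sum of the generators on which [u] is [1].  As these span, a
    basis vector [e] of the lattice combines them with real coefficients, and
    [e + K s] does so with nonnegative ones for large [K].  There the gauge is
    [u], so [pairing u e] is the gauge of [e + K s] minus [K * pairing u s]. *)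
Lemma spanning_normal_integral u : polar P u -> spanning_normal u ->
  (forall x, x \in V -> exists z, x = of_lattice z) ->
  (forall z, gauge P (of_lattice z) \is a Num.int) ->
  exists z, u = of_lattice z.
Proof.
move=> Pu uspan VL gL; pose F := [seq x <- V | pairing u x == 1].
pose s i := tnth (in_tuple F) i.
have sF i : s i \in V /\ pairing u (s i) = 1.
  by have := mem_tnth i (in_tuple F); rewrite mem_filter => /andP[/eqP].
pose A := \matrix_i s i.
have fullA : row_full A.
  rewrite /row_full -mxrank_tr -/(row_free A^T) -kermx_eq0; apply/eqP/row_matrixP => k.
  rewrite row0; apply: uspan => x xV ux.
  have : x \in F by rewrite mem_filter ux eqxx.
  move=> /(tnthP (in_tuple F))[i ->].
  have : row k (kermx A^T) *m A^T = 0 by apply/sub_kermxP; exact: row_sub.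
  move=> /rowP/(_ i); rewrite mxE mxE => <-; rewrite pairingE.
  by apply: eq_bigr => j _; rewrite !mxE.
have [z0 s0E] : exists z, \sum_i s i = of_lattice z.
  by apply: lattice_sum => i; apply: VL; case: (sF i).
have us0 : pairing u (\sum_i s i) = (size F)%:R.
  under eq_bigr do rewrite -[s _]scale1r.
  rewrite pairing_sumr; under eq_bigr => i _ do rewrite (proj2 (sF i)) mulr1.
  by rewrite sumr_const card_ord.
suff uint j : u 0 j \is a Num.int.
  have /choice[c uc] : forall j, exists m : int, u 0 j = m%:~R by move=> j; apply/intrP.
  by exists (\row_j c j); apply/rowP => j; rewrite !mxE.
pose e : 'rV[int]_n := delta_mx 0 j.
have eE : of_lattice e = delta_mx 0 j :> 'rV[R]_n by rewrite /of_lattice map_delta_mx.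
have [D eD] := submxP (submx_full (of_lattice e) fullA).
have [M M0 DM] := seq_bounded (fun i => - D 0 i) (enum 'I_(size F)).
pose K := Num.Def.archi_bound M.
have KD i : 0 <= D 0 i + K%:R.
  rewrite addrC -lerBlDr sub0r (le_trans (DM i (mem_enum _ i))) //.
  by rewrite ltW // archi_boundP // ltW.
have xE : of_lattice (e + z0 *+ K) = \sum_i (D 0 i + K%:R) *: s i.
  rewrite of_latticeD of_latticeMn -s0E eD scaler_sumr mulmx_sum_row -big_split /=.
  by apply: eq_bigr => i _; rewrite rowK scalerDl.
have : gauge P (of_lattice (e + z0 *+ K)) = pairing u (of_lattice (e + z0 *+ K)).
  apply: (gauge_on_cone P0 (F := [set` F]) Pu).
    move=> x /=; rewrite mem_filter => /andP[/eqP ux xV].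
    by split=> //; apply: generator_in_polytope.
  exists (size F), s, (fun i => D 0 i + K%:R); split=> // i.
  by rewrite /= mem_tnth.
rewrite of_latticeD of_latticeMn -s0E pairingDr pairingZr us0 eE pairing_delta.
move=> /eqP; rewrite -subr_eq => /eqP <-.
rewrite -eE s0E -of_latticeMn -of_latticeD; apply: rpredB; first exact: gL.
by rewrite rpredM // rpred_nat.
Qed.

(** A point of the polar outside the hull of the lattice points of the polar
    would be separated from it by some [v], but the maximum of [v] on the polar
    is reached at an integral facet normal. *)
Lemma polar_lattice_polytope :
  (forall x, x \in V -> exists z, x = of_lattice z) ->
  (forall z, gauge P (of_lattice z) \is a Num.int) ->
  lattice_polytope (polar P).
Proof.
move=> VL gL.
have /finite_seqP[T TE] : finite_set [set z | polar P (of_lattice z)].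
  apply: finite_lattice_set => v; exists (gauge P v) => w.
  exact: pairing_le_gauge.
have polT z : (z \in T) <-> polar P (of_lattice z).
  by rewrite -[polar P _]/([set w | polar P (of_lattice w)] z) TE.
have TmapE : of_lattice @` [set` T] = [set` map (@of_lattice R n) T].
  apply/seteqP; split=> [_ [z zT <-]|_ /mapP[z zT ->]]; last by exists z.
  by rewrite /= map_f.
exists T; rewrite TmapE; apply/seteqP; split=> y.
  move=> Py; apply: contrapT => /convex_hull_separation[v [c [Tc cv]]].
  have [u [Pu uv uspan]] := gauge_attained_spanning v.
  have [z uz] := spanning_normal_integral Pu uspan VL gL.
  have : gauge P v <= c.
    by rewrite -uv pairingC Tc // uz map_f //; apply/polT; rewrite -uz.
  move=> /le_lt_trans/(_ cv); rewrite ltNge => /negP; apply.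
  by rewrite pairingC pairing_le_gauge.
move=> Ty x Px; rewrite pairingC; apply: pairing_convex_hull_le Ty.
by move=> _ /mapP[z /polT Pz ->]; rewrite pairingC; apply: Pz.
Qed.

End FacetNormals.

(** * Multiplication of series by polynomials *)

Section GeneralizedSeries.
Context {R : realType}.
Implicit Types (f : gseries R) (p q : {poly int}).

Lemma poly_mul_gseriesE m q f a : (size q <= m)%N ->
  poly_mul_gseries q f a = \sum_(i < m) q`_i * f (a - i%:R).
Proof.
move=> qm; rewrite /poly_mul_gseries.
rewrite (big_ord_widen m (fun i => q`_i * f (a - i%:R)) qm) big_mkcond /=.
apply: eq_bigr => i _; case: ltnP => // qi.
by rewrite nth_default // mul0r.
Qed.

(** An instance of associativity: multiplying a series by
    [1 - z] takes its backward difference. *)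
Lemma poly_mul_gseries_difference q f :
  poly_mul_gseries (q * (1 - 'X)) f =
  poly_mul_gseries q (fun a => f a - f (a - 1)).
Proof.
apply/funext => a.
have sq : (size (q * (1 - 'X))%R <= (size q).+1)%N.
  apply: leq_trans (size_polyMleq _ _) _.
  have : (size (1 - 'X : {poly int})%R <= 2)%N.
    by rewrite (leq_trans (size_polyD _ _)) // size_polyN size_polyX size_poly1.
  lia.
rewrite (poly_mul_gseriesE _ _ sq).
under eq_bigr do rewrite mulrBr mulr1 coefB coefMX mulrBl.
rewrite sumrB -(poly_mul_gseriesE f a (leqnSn _)) big_ord_recl /= mul0r add0r.
rewrite -sumrB; apply: eq_bigr => i _; rewrite mulrBr; congr (_ - _ * f _).
by rewrite /bump leq0n natrD opprD addrA addrAC.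
Qed.

(** At the least exponent [a] of [f] in a given class modulo the integers, the
    product with [q] has coefficient [q`_0 * f a], which is not [0]. *)
Lemma gseries_integral_exponents p q f : q`_0 != 0 ->
  (forall a, a < 0 -> f a = 0) ->
  poly_mul_gseries q f = gseries_of_poly p ->
  forall a, a \isn't a Num.int -> f a = 0.
Proof.
move=> q0 f0 qfp a; have [/f0//|/archi_boundP] := ltP a 0.
move: (Num.Def.archi_bound a) => N; elim: N a => [|N IH] a aN aint.
  exact: f0.
have /(congr1 (fun g => g a)) := qfp.
rewrite (poly_mul_gseriesE _ _ (leqnSn _)) big_ord_recl subr0 big1 ?addr0.
  rewrite /gseries_of_poly big1 => [/eqP|i _].
    by rewrite mulf_eq0 (negPf q0) => /eqP.
  have [ai|_] := eqVneq a _; last by rewrite mulr0.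
  by rewrite ai rpred_nat in aint.
move=> i _; rewrite IH ?mulr0 //=.
  rewrite ltrBlDr (lt_le_trans aN) // -[leLHS]natr1 lerD2l.
  by rewrite ler1n.
by rewrite rpredBr // rpred_nat.
Qed.

End GeneralizedSeries.

(** * Counting lattice points by gauge *)

Section LatticePoints.
Local Open Scope classical_set_scope.
Context {R : realType} {n : nat} (V : seq 'rV[R]_n).
Let P := convex_hull [set` V].
Context (P0 : interior P 0).
Implicit Types (z : 'rV[int]_n).

(** The maximum of a functional on the hull of lattice points is reached at one
    of them. *)
Lemma reflexive_gauge_integral : lattice_polytope (polar P) ->
  forall z, gauge P (of_lattice z) \is a Num.int.
Proof.
move=> [T PT] z; pose v : 'rV[R]_n := of_lattice z.
have [u Pu uv] := gauge_attained P0 v.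
have leT y : (@of_lattice R n @` [set` T]) y -> pairing v y <= gauge P v.
  by move=> Ty; rewrite pairingC pairing_le_gauge // PT; apply: sub_convex_hull.
have [||[|k] [a [t [aT _ t1 _]]]] := @convex_hull_face _ _ _ v _ leT u _ _.
- by rewrite -PT.
- by rewrite pairingC.
- by move/eqP: t1; rewrite big_ord0 eq_sym oner_eq0.
have [[y yT ya] /= <-] := aT ord0.
by rewrite -ya pairing_lattice.
Qed.

Lemma finite_gauge_le (c : R) : finite_set [set z | gauge P (of_lattice z) <= c].
Proof.
apply: finite_lattice_set => v; have [e e0 Pev] := polar_absorbing V v.
exists (e^-1 * c) => z /= zc.
by rewrite ler_pdivlMl // -pairingZr pairingC (le_trans (pairing_le_gauge P0 _ Pev)).
Qed.

Definition count_gauge_le (c : R) : nat :=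
  #|` fset_set [set z | gauge P (of_lattice z) <= c]|.

(** At [m = 0] the constant term [1] counts the origin, the only lattice point
    of gauge [0]. *)
Lemma ehrhart_series_nat (m : nat) :
  ehrhart_series P (m%:R : R) = (count_gauge_le m%:R)%:Z.
Proof.
rewrite /ehrhart_series /gseries_of_nat rpred_nat natrK; case: eqP => [->|_].
  rewrite /count_gauge_le; have -> : [set z | gauge P (of_lattice z) <= 0] = [set 0].
    apply/seteqP; split=> z /=.
      move=> z0; have : gauge P (of_lattice z) == 0 by rewrite eq_le z0 gauge_ge0.
      rewrite gauge_eq0 // => /eqP/rowP zE; apply/rowP => j.
      by have /eqP := zE j; rewrite !mxE intr_eq0 => /eqP.
    by move=> ->; rewrite /of_lattice map_mx0 gauge0.
  by rewrite fset_set1 cardfs1.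
congr (Posz #|` fset_set _|); apply/seteqP; split=> z /=.
  by move=> [x Px xz]; apply/(gauge_le_dilate P0 _ (ler0n _ m)); exists x.
by move=> /(gauge_le_dilate P0 _ (ler0n _ m)) [x Px xz]; exists x.
Qed.

Lemma newton_series_difference :
  newton P = gauge P -> (forall z, gauge P (of_lattice z) \is a Num.int) ->
  forall a : R, newton_series P a = ehrhart_series P a - ehrhart_series P (a - 1).
Proof.
move=> PE gint a.
have gnat z : gauge P (of_lattice z) \is a Num.nat.
  by rewrite natrEint gint gauge_ge0.
rewrite /newton_series PE.
have [/natrP[m ->]|anat] := boolP (a \is a Num.nat); last first.
  rewrite [in RHS]/ehrhart_series /gseries_of_nat (negPf anat).
  have -> : [set z | gauge P (of_lattice z) = a] = set0.
    by apply/seteqP; split=> // z /= za; rewrite -za gnat in anat.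
  rewrite fset_set0 cardfs0 ifN ?subrr //; apply: contra anat => a1.
  by rewrite -(subrK 1 a) rpredD // rpred1.
rewrite ehrhart_series_nat; case: m => [|m].
  have -> : ehrhart_series P (0%:R - 1 : R) = 0.
    rewrite /ehrhart_series /gseries_of_nat ifN // sub0r.
    by rewrite natrEint lerNr oppr0 ler10 andbF.
  rewrite subr0; congr (Posz #|` fset_set _|); apply/seteqP; split=> z /=.
    by move=> ->.
  by move=> z0; apply/eqP; rewrite eq_le z0 gauge_ge0.
rewrite -[X in X - 1]natr1 addrK ehrhart_series_nat /count_gauge_le.
set A := [set z | _ = _]; set B := [set z | _ <= m%:R].
have -> : [set z | gauge P (of_lattice z) <= m.+1%:R] = A `|` B.
  apply/seteqP; split=> z; rewrite /A /B /=.
    have /natrP[k ->] := gnat z; rewrite !ler_nat leq_eqVlt => /orP[/eqP->|].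
      by left.
    by right.
  case=> [->//|zm]; apply: le_trans zm _; by rewrite ler_nat.
have finB : finite_set B by exact: finite_gauge_le.
have finA : finite_set A.
  apply: sub_finite_set (finite_gauge_le m.+1%:R) => z; by rewrite /A /= => ->.
rewrite fset_setU //.
have := cardfsUI (fset_set A) (fset_set B).
rewrite -fset_setI // (_ : A `&` B = set0) ?fset_set0 ?cardfs0.
  by rewrite addn0 => ->; rewrite PoszD addrK.
apply/seteqP; split=> // z [] /=; rewrite /A /B /= => ->.
by rewrite ler_nat ltnn.
Qed.

(** The cardinal of an infinite set would be [0] by convention, so the
    finiteness of the level sets matters. *)
Lemma newton_series_neq0 z : newton P = gauge P ->
  newton_series P (gauge P (of_lattice z)) != 0.
Proof.
move=> PE; rewrite /newton_series PE.
rewrite (_ : (_ == 0) = (#|` fset_set [set w | gauge P (of_lattice w) =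
  gauge P (of_lattice z)]| == 0%N)) // cardfs_eq0; apply/eqP => /fset_set_set0 A0.
have : set0 z; last by [].
rewrite -A0 //; apply: sub_finite_set (finite_gauge_le (gauge P (of_lattice z))).
by move=> w /= ->.
Qed.

End LatticePoints.

(** * The equivalence *)

Theorem proposition5p1 (R : realType) (n : nat) (P : set 'rV[R]_n)
    (delta : {poly int})
    (hP : lattice_polytope P) (hdim : full_dimensional P)
    (h0 : interior P 0) (hsimp : simplicial_fan P)
    (hdelta : is_delta_vector P delta) :
  [<-> exists p : {poly int}, newton_spectrum P = gseries_of_poly p;
       reflexive_polytope P;
       newton_spectrum P = gseries_of_poly delta].
Proof.
have [S PS] := hP.
have [V [VS VE vertexV]] := convex_hull_vertices (map (@of_lattice R n) S).
have PV : P = convex_hull [set` V]%classic.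
  rewrite VE PS; congr convex_hull; apply/seteqP; split=> [_ [z zS <-]|x].
    by rewrite /= map_f.
  by move=> /mapP[z zS ->]; exists z.
have VL x : x \in V -> exists z, x = of_lattice z.
  by move=> /VS/mapP[z _ ->]; exists z.
rewrite -VE -PV in vertexV.
have {}hdelta := proj2 hdelta.
rewrite {hdim hsimp PS VE}PV in hP h0 vertexV hdelta *.
have PE := newtonE h0 vertexV.
tfae.
- move=> [p Pp]; split=> //; apply: polar_lattice_polytope => // z.
  apply/negPn/negP => /(gseries_integral_exponents _ _ Pp) zz.
  move: (newton_series_neq0 h0 z PE); rewrite zz ?eqxx //.
    by rewrite -horner_coef0 hornerE !hornerE expr1n.
  move=> a a0; rewrite /newton_series PE.
  rewrite (_ : [set w | _]%classic = set0) ?fset_set0 ?cardfs0 //.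
  apply/seteqP; split=> // w /= wa.
  by rewrite -wa ltNge gauge_ge0 in a0.
- move=> [_ _ /(reflexive_gauge_integral h0) gint].
  rewrite -hdelta exprSr poly_mul_gseries_difference; congr poly_mul_gseries.
  by apply/funext => a; apply: newton_series_difference.
- by exists delta.
Qed.
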